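(* Let $\Gamma$ be a finite alphabet with involution $a\mapsto\bar a$ and let $\Omega$ be a finite set of variables with a fixed-point-free involution $X\mapsto\bar X$, $\Omega=\Omega_+\sqcup\{\bar X: X\in\Omega_+\}$. Let $L_i=R_i$ ($1\le i\le k$) be a system of word equations with $L_i,R_i\in\Omega^*$, in which every variable of $\Omega_+$ occurs, and let $\sigma:\Omega_+\to\Gamma^*$ be any solution. Let $d=\sum_{i=1}^k|L_iR_i|$ be the denotational length of the system, let $\tilde\sigma:\Omega_+\to\tilde\Gamma^*$ be the generic solution specified by $\sigma$ (defined in the context), and let $\tilde N=\sum_{i=1}^k|\tilde\sigma(L_i)|$ be its length. Then there is a straight-line program $S$ over the alphabet $\tilde\Gamma$ of size $O(d^2\cdot\log^2\tilde N)$ such that each $X\in\Omega_+$ is also a variable of $S$ and satisfies $\mathrm{eval}(X)=\tilde\sigma(X)$.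
   Context: Words and involution: the involution on $\Gamma$ extends to $\Gamma^*$ by $\overline{a_1\cdots a_n}=\bar a_n\cdots\bar a_1$; a solution is a map $\sigma:\Omega_+\to\Gamma^*$, extended to a morphism $\Omega^*\to\Gamma^*$ by $\sigma(\bar X)=\overline{\sigma(X)}$, with $\sigma(L_i)=\sigma(R_i)$ for all $i$. For a word $w=a_1\cdots a_m$ the positions are $0,\dots,m$; for positions $\alpha\le\beta$ put $w[\alpha,\beta]=a_{\alpha+1}\cdots a_\beta$ and $w[\beta,\alpha]=\overline{w[\alpha,\beta]}$; $[\alpha,\beta]$ is an interval and $\overline{[\alpha,\beta]}=[\beta,\alpha]$. Generic solution: for each equation write $L_i=X_1\cdots X_g$, $R_i=X_{g+1}\cdots X_{d_i}$ and $w_i=\sigma(L_i)=\sigma(R_i)$. Each occurrence $j$ of a variable $X_j$ determines positions $\mathrm l(j)$, $\mathrm r(j)$ in $w_i$ where $\sigma(X_j)$ starts and ends in the corresponding factorization of $w_i$; these positions are called cuts. Let $\approx$ be the equivalence relation on intervals (of all the $w_i$) generated by: for any two occurrences $j,j'$ with $X_j=X_{j'}$ and all $0\le\mu,\nu\le \mathrm r(j)-\mathrm l(j)$, $[\mathrm l(j)+\mu,\mathrm l(j)+\nu]\sim[\mathrm l(j')+\mu,\mathrm l(j')+\nu]$, and if $X_j=\overline{X_{j'}}$, $[\mathrm l(j)+\mu,\mathrm l(j)+\nu]\sim[\mathrm r(j')-\mu,\mathrm r(j')-\nu]$. An interval $[\alpha,\beta]$ is free if for every $[\alpha',\beta']\approx[\alpha,\beta]$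 there is no cut $\gamma$ with $\min\{\alpha',\beta'\}<\gamma<\max\{\alpha',\beta'\}$; it is maximal free if it is free and not strictly contained (as $[\min,\max]$) in a longer free interval. Let $\tilde\Gamma$ be the set of $\approx$-classes of maximal free intervals, with involution induced by $[\alpha,\beta]\mapsto[\beta,\alpha]$. Each $w_i$ factors as $w_i[\alpha_0,\alpha_1]\cdots w_i[\alpha_{\ell-1},\alpha_\ell]$ into maximal free intervals (all cuts being among the $\alpha_t$), and reading each factor $\sigma(X)$ as the word of the classes of these intervals yields $\tilde\sigma:\Omega_+\to\tilde\Gamma^*$, the generic solution specified by $\sigma$. Straight-line programs (SLPs) over an alphabet with involution $A$: a finite set of variables with fixed-point-free involution and a partial order $<$, and for each positive variable $X$ exactly one rule, either $X\to a$ with $a\in A\cup\{1\}$ ($1$ the empty word) or $X\to YZ$ with $X<Y$, $X<\bar Y$, $X<Z$, $X<\bar Z$. Evaluation: $\mathrm{eval}(X)=a$, resp. $\mathrm{eval}(X)=\mathrm{eval}(Y)\mathrm{eval}(Z)$, and $\mathrm{eval}(\bar X)=\overline{\mathrm{eval}(X)}$. The size of an SLP is its number of rules. *)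

(* Defs.v *)
From Stdlib Require Import Relation_Operators ClassicalDescription.
From Stdlib Require List.
From mathcomp Require Import all_boot.

Set Implicit Arguments.
Unset Strict Implicit.
Unset Printing Implicit Defensive.

Definition decP (Q : Prop) : bool :=
  if excluded_middle_informative Q then true else false.

Definition winv (A : Type) (ainv : A -> A) (w : seq A) : seq A :=
  rev (map ainv w).

(* Variables: Omega = Omega_+ (the finType P) disjoint-union bar Omega_+.
   A literal (X, b) is X if b = false and bar X if b = true; the
   involution is (X,b) |-> (X, ~~ b), which is fixed-point-free. *)
Definition lit (P : Type) := (P * bool)%type.

Definition equation (P : Type) := (seq (lit P) * seq (lit P))%type.

Section System.
Variables (G : finType) (ginv : G -> G) (P : finType).
Variables (sys : seq (equation P)) (sigma : P -> seq G).

Definition sol_lit (x : lit P) : seq G :=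
  if x.2 then winv ginv (sigma x.1) else sigma x.1.
Definition sol_word (u : seq (lit P)) : seq G := flatten (map sol_lit u).

Definition is_solution : Prop :=
  forall e, e \in sys -> sol_word e.1 = sol_word e.2.

Definition all_vars_occur : Prop :=
  forall X : P, exists2 e, e \in sys & has (fun x : lit P => x.1 == X) (e.1 ++ e.2).

Definition dlen : nat := \sum_(e <- sys) (size e.1 + size e.2).

Definition eqn (i : nat) : equation P := nth ([::], [::]) sys i.

Definition w (i : nat) : seq G := sol_word (eqn i).1.

(* occurrences of literals of a side, with their left position l(j);
   the right position is r(j) = l(j) + |sigma(X_j)| *)
Fixpoint occs_from (n : nat) (u : seq (lit P)) : seq (lit P * nat) :=
  match u with
  | [::] => [::]
  | x :: u' => (x, n) :: occs_from (n + size (sol_lit x)) u'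
  end.

Definition occs (i : nat) : seq (lit P * nat) :=
  occs_from 0 (eqn i).1 ++ occs_from 0 (eqn i).2.

Definition is_cut (i gamma : nat) : Prop :=
  exists x l, (x, l) \in occs i /\
    (gamma = l \/ gamma = l + size (sol_lit x)).

(* intervals (i, alpha, beta) : the interval [alpha, beta] of w_i *)
Definition interval := (nat * nat * nat)%type.
Definition ieq (I : interval) := I.1.1.
Definition ilo (I : interval) := minn I.1.2 I.2.
Definition ihi (I : interval) := maxn I.1.2 I.2.
Definition iswap (I : interval) : interval := (I.1.1, I.2, I.1.2).

Definition valid_interval (I : interval) : Prop :=
  ieq I < size sys /\ I.1.2 <= size (w (ieq I)) /\ I.2 <= size (w (ieq I)).

Definition gen_rel (I J : interval) : Prop :=
  exists (i : nat) (x : lit P) (l : nat) (i' : nat) (x' : lit P) (l' mu nu : nat),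
    [/\ i < size sys, (x, l) \in occs i, i' < size sys, (x', l') \in occs i'
      & x.1 = x'.1] /\
    mu <= size (sigma x.1) /\ nu <= size (sigma x.1) /\
    I = (i, l + mu, l + nu) /\
    J = (if x.2 == x'.2 then (i', l' + mu, l' + nu)
         else (i', l' + size (sigma x.1) - mu, l' + size (sigma x.1) - nu)).

Definition approx : interval -> interval -> Prop :=
  clos_refl_sym_trans interval gen_rel.

Definition free (I : interval) : Prop :=
  valid_interval I /\
  forall J, approx J I -> forall gamma, is_cut (ieq J) gamma ->
    ~ (ilo J < gamma /\ gamma < ihi J).

Definition maxfree (I : interval) : Prop :=
  free I /\
  ~ (exists J, free J /\ ieq J = ieq I /\ ilo J <= ilo I /\ ihi I <= ihi J /\
               ihi I - ilo I < ihi J - ilo J).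

(* positions alpha_0 < ... < alpha_l of the factorization of w_i into
   maximal free intervals: the endpoints of nonempty maximal free intervals *)
Definition bp (i : nat) : seq nat :=
  [seq g <- iota 0 (size (w i)).+1 |
     decP (exists b, b <> g /\ maxfree (i, g, b))].

Fixpoint consec (s : seq nat) : seq (nat * nat) :=
  match s with
  | a :: ((b :: _) as s') => (a, b) :: consec s'
  | _ => [::]
  end.

(* N~ = sum_i |sigma~(L_i)| = number of factors of w_i *)
Definition Ntilde : nat := \sum_(i < size sys) (size (bp i)).-1.

Definition all_occs : seq (nat * (lit P * nat)) :=
  flatten [seq [seq (i, o) | o <- occs i] | i <- iota 0 (size sys)].

Definition first_occ (X : P) : nat * (lit P * nat) :=
  nth (0, ((X, false), 0)) all_occs
      (find (fun o : nat * (lit P * nat) => o.2.1.1 == X) all_occs).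

Definition occ_word (i : nat) (x : lit P) (l : nat) : seq interval :=
  [seq (i, p.1, p.2) | p <- consec [seq g <- bp i | l <= g <= l + size (sol_lit x)]].

(* sigma~(X), as a word of representatives of the classes in Gamma~,
   read off an occurrence of X (or of bar X) *)
Definition sigma_tilde (X : P) : seq interval :=
  let: (i, (x, l)) := first_occ X in
  if x.2 then winv iswap (occ_word i x l) else occ_word i x l.

End System.

(* Positive variables: a finite type Q; all variables: Q * bool.        *)
Inductive rhs (A Q : Type) :=
| Leaf of option A                  (* X -> a  or  X -> 1 (None) *)
| Node of (Q * bool) & (Q * bool).

Arguments Leaf {A Q}.
Arguments Node {A Q}.

Section SLP.
Variables (A : Type) (ainv : A -> A) (Q : finType) (rules : Q -> rhs A Q).

Definition slp_ordered : Prop :=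
  exists lt : Q * bool -> Q * bool -> Prop,
    (forall v, ~ lt v v) /\
    (forall u v x, lt u v -> lt v x -> lt u x) /\
    (forall X y z, rules X = Node y z ->
       [/\ lt (X, false) y, lt (X, false) (y.1, ~~ y.2),
           lt (X, false) z & lt (X, false) (z.1, ~~ z.2)]).

Fixpoint evalF (n : nat) (v : Q * bool) : seq A :=
  match n with
  | 0 => [::]
  | n'.+1 =>
      let wv := match rules v.1 with
                | Leaf None => [::]
                | Leaf (Some a) => [:: a]
                | Node y z => evalF n' y ++ evalF n' z
                end in
      if v.2 then winv ainv wv else wv
  end.

(* evaluation; for an ordered SLP the recursion depth is at most #|Q|,
   so this fuel is sufficient *)
Definition eval (v : Q * bool) : seq A := evalF #|Q|.+1 v.

End SLP.

(* size = number of rules = number of positive variables *)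
Definition slp_size (A : Type) (Q : finType) (rules : Q -> rhs A Q) : nat := #|Q|.

(* Main.v *)
Require Import Defs.
From Stdlib Require Import Relation_Operators Classical ClassicalDescription.
From Stdlib Require List.
From mathcomp Require Import all_boot.
From mathcomp Require Import zify.

Set Implicit Arguments.
Unset Strict Implicit.
Unset Printing Implicit Defensive.

(** In the generic solution every factor of length at least 2 is not free, so
    it has an equivalent occurrence with a cut strictly inside.  For every cut
    and every [k], keep the words of length [2 ^ k] on both sides of the cut.
    The one of length [2 ^ k.+1] is the one of length [2 ^ k] extended by a
    factor of length at most [2 ^ k]; moved across a cut, that factor becomes a
    suffix followed by a prefix of words kept at level [k].  Truncating a word
    does not increase the height of its derivation and costs at most that
    height in new words, and the height grows by 2 per level, so that
    [O(d log^2 N)] words suffice.  Ordering words by length makes them an SLP. *)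

(** * Families of words closed under decomposition *)

(** The grammar consists of words, not of intervals, so its letters must coincide whenever the
    classes do: each class gets one chosen representative, and the delicate point is that equivalent
    intervals spell literally the same word. For this, breakpoints are recognised by a local test,
    the freeness of the length-two interval around a position, which travels along [gen_rel]; the
    maximality of an interval is not visibly local. Since the equivalence may also reverse an
    interval, every cut contributes its two neighbouring words in both reading directions. Heights
    are recorded because a truncation is paid for by one path of a derivation: with growth 2 per
    level such a path has length O(log N), and O(log N) levels of O(d) words produce the square of
    the logarithm. The count is linear in d and is weakened to d^2 only at the very end. *)

Section Grammars.
Variable A : eqType.
Implicit Types (u v f x y z : seq A) (D E : seq (seq A * nat)).

(* An entry [(u, h)] of a grammar is a word together with a bound on the
   height of its derivation. *)
Definition below D (h : nat) u := exists2 h', h' < h & (u, h') \in D.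

(** Nonempty parts are strictly shorter than [u], which later orders the rules; the strict bound
    inside [below] drives the inductions on height. *)
Definition parsed D (h : nat) u :=
  size u <= 1 \/
  exists y z, [/\ u = y ++ z, 0 < size y, 0 < size z, below D h y & below D h z].

Definition closed D := forall u h, (u, h) \in D -> parsed D h u.

Lemma belowW D D' h h' u :
  h <= h' -> {subset D <= D'} -> below D h u -> below D' h' u.
Proof.
by move=> hh sD [k kh uD]; exists k; [apply: leq_trans kh hh | apply: sD].
Qed.

Lemma below_cat D E h u : below D h u -> below (E ++ D) h u.
Proof. by apply: belowW => // e eD; rewrite mem_cat eD orbT. Qed.

Lemma below_cons D e h u : below D h u -> below (e :: D) h u.
Proof. exact: (@below_cat D [:: e]). Qed.

Lemma below_head D h u : below ((u, h) :: D) h.+1 u.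
Proof. by exists h; rewrite ?inE ?eqxx. Qed.

Lemma closed_cons D h u : closed D -> parsed D h u -> closed ((u, h) :: D).
Proof.
have mono k v : parsed D k v -> parsed ((u, h) :: D) k v.
  case=> [|[y [z [-> y0 z0 yD zD]]]]; first by left.
  by right; exists y, z; split=> //; apply: below_cons.
move=> cD pu v k; rewrite inE => /orP[/eqP[-> ->]|/cD]; exact: mono.
Qed.

(* Truncating a word replaces the entries along one path of its derivation
   by shorter ones of the same height. *)
Lemma below_prefix D h u v : closed D -> below D h (u ++ v) ->
  exists E, [/\ size E <= h, closed (E ++ D) & below (E ++ D) h u].
Proof.
elim: h u v D => [|h IH] u v D cD [k kh uvD]; first by [].
case: (cD _ _ uvD) => [uv1|[y [z [uvE y0 z0 yD zD]]]].
  exists [:: (u, h)]; split=> //; last exact: below_head.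
  by apply: closed_cons => //; left; rewrite size_cat in uv1; lia.
have kh' : k <= h by [].
have uE : u = take (size u) (y ++ z) by rewrite -uvE take_size_cat.
have vE : v = drop (size u) (y ++ z) by rewrite -uvE drop_size_cat.
(* If [u] ends inside [y], the descent is free of charge. Otherwise [y] is kept whole, only [z] is
   truncated, and one entry is paid for [u]. *)
case: (leqP (size u) (size y)) => uy.
  have yE : y = u ++ drop (size u) y.
    by rewrite {1}uE takel_cat // cat_take_drop.
  rewrite yE in yD; have [|E [sE cE bE]] := IH _ _ _ cD (belowW kh' _ yD) => //.
  by exists E; split=> //; [lia | apply: belowW bE].
have uE' : u = y ++ take (size u - size y) z.
  by rewrite {1}uE take_cat ltnNge (ltnW uy).
rewrite -(cat_take_drop (size u - size y) z) in zD.
have [|E [sE cE bE]] := IH _ _ _ cD (belowW kh' _ zD) => //.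
exists ((u, h) :: E); split=> //; last exact: below_head.
apply: closed_cons => //; right; exists y, (take (size u - size y) z); split=> //.
  by move: uy; rewrite {1}uE' size_cat; lia.
by apply: below_cat; apply: belowW yD.
Qed.

Lemma below_suffix D h u v : closed D -> below D h (v ++ u) ->
  exists E, [/\ size E <= h, closed (E ++ D) & below (E ++ D) h u].
Proof.
elim: h u v D => [|h IH] u v D cD [k kh uvD]; first by [].
case: (cD _ _ uvD) => [uv1|[y [z [uvE y0 z0 yD zD]]]].
  exists [:: (u, h)]; split=> //; last exact: below_head.
  by apply: closed_cons => //; left; rewrite size_cat in uv1; lia.
have kh' : k <= h by [].
have uE : u = drop (size v) (y ++ z) by rewrite -uvE drop_size_cat.
have [vy|vy] := leqP (size y) (size v).
  have zE : z = take (size v - size y) z ++ u.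
    by rewrite uE drop_cat ltnNge vy /= cat_take_drop.
  rewrite zE in zD; have [|E [sE cE bE]] := IH _ _ _ cD (belowW kh' _ zD) => //.
  by exists E; split=> //; [lia | apply: belowW bE].
have uE' : u = drop (size v) y ++ z by rewrite uE drop_cat vy.
rewrite -(cat_take_drop (size v) y) in yD.
have [|E [sE cE bE]] := IH _ _ _ cD (belowW kh' _ yD) => //.
exists ((u, h) :: E); split=> //; last exact: below_head.
apply: closed_cons => //; right; exists (drop (size v) y), z; split=> //.
  by rewrite size_drop; lia.
by apply: below_cat; apply: belowW zD.
Qed.

(* [Q] stands for any property of grammars that survives extension. *)
Lemma below_all (Q : seq (seq A * nat) -> Prop) (L : seq (seq A)) c h D :
  (forall D E, Q D -> Q (E ++ D)) -> Q D -> closed D ->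
  (forall f D, f \in L -> Q D -> closed D ->
     exists E, [/\ size E <= c, closed (E ++ D) & below (E ++ D) h f]) ->
  exists E, [/\ size E <= c * size L, closed (E ++ D)
              & forall f, f \in L -> below (E ++ D) h f].
Proof.
move=> Qmono; elim: L D => [|f L IH] D QD cD stepL.
  by exists [::]; split.
have [E [sE cE fE]] := stepL f D (mem_head _ _) QD cD.
have [|E' [sE' cE' LE']] := IH (E ++ D) (Qmono _ _ QD) cE.
  by move=> g D' gL; apply: stepL; rewrite inE gL orbT.
exists (E' ++ E); rewrite -catA; split=> //; first by rewrite size_cat /=; lia.
by move=> g; rewrite inE => /orP[/eqP->|/LE' //]; apply: below_cat.
Qed.

End Grammars.

(** * Words of length [2 ^ k] next to the cuts *)

Section CutWords.
Variables (A : eqType) (T : seq (seq A * seq A)).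
Implicit Types (u v f x y z : seq A) (D E : seq (seq A * nat)).

Definition cut_factor f :=
  exists x y u v, (x, y) \in T /\ x ++ y = u ++ f ++ v.

(** Combinatorial form of non-freeness: a pair in [T] holds the words to the left and to the right
    of a cut, and [f] reappears across one. *)
Hypothesis cross_cut : forall f, cut_factor f -> 1 < size f ->
  exists x y s t, [/\ (x ++ s, t ++ y) \in T, f = s ++ t, 0 < size s & 0 < size t].

Definition last_k k x := drop (size x - k) x.

Definition level k D := forall x y, (x, y) \in T ->
  below D k.*2.+1 (last_k (2 ^ k) x) /\ below D k.*2.+1 (take (2 ^ k) y).

Lemma level_cat k D E : level k D -> level k (E ++ D).
Proof. by move=> lD x y /lD[? ?]; split; apply: below_cat. Qed.

(* A factor of length at most [2 ^ k] also occurs across a cut, hence inside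
   the known words of length [2 ^ k] on both sides of that cut. *)
Lemma below_factor k D f : closed D -> level k D -> cut_factor f ->
  size f <= 2 ^ k ->
  exists E, [/\ size E <= 4 * k + 3, closed (E ++ D) & below (E ++ D) k.*2.+2 f].
Proof.
move=> cD lD ff sf; case: (leqP (size f) 1) => f1.
  exists [:: (f, 0)]; split; [by rewrite /=; lia | | by exists 0; rewrite ?inE ?eqxx].
  by apply: closed_cons => //; left.
have [x [y [s [t [xyT fE s0 t0]]]]] := cross_cut ff f1.
have [xD yD] := lD _ _ xyT.
(* As [s] is no longer than [f], the stored word to the left of the cut contains all of [s], as a
   suffix. *)
have sE : last_k (2 ^ k) (x ++ s) = drop (size (x ++ s) - 2 ^ k) x ++ s.
  rewrite fE size_cat in sf; rewrite /last_k drop_cat; case: ifP => // xs.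
  rewrite size_cat in xs *; have -> : size x + size s - 2 ^ k - size x = 0 by lia.
  by rewrite drop0 drop_oversize //; lia.
have tE : take (2 ^ k) (t ++ y) = t ++ take (2 ^ k - size t) y.
  by rewrite fE size_cat in sf; rewrite take_cat ifF //; lia.
rewrite sE in xD; have [E [szE cE sED]] := below_suffix cD xD.
rewrite tE in yD; have [F [szF cF tFD]] := below_prefix cE (below_cat E yD).
(* Two truncations of at most [2 * k + 1] entries each and one entry for [f] give [4 * k + 3]. *)
exists ((f, k.*2.+1) :: F ++ E); rewrite cat_cons -catA; split.
- by rewrite /= size_cat; lia.
- by apply: closed_cons => //; right; exists s, t; split=> //; apply: below_cat.
- exact: below_head.
Qed.

Lemma level0 : exists D, [/\ size D <= 2 * size T, closed D & level 0 D].
Proof.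
pose D := [seq (last_k 1 p.1, 0) | p <- T] ++ [seq (take 1 p.2, 0) | p <- T].
exists D; split; first by rewrite size_cat !size_map; lia.
  move=> u h; rewrite mem_cat => /orP[] /mapP[p _ [-> _]]; left.
    by rewrite /last_k size_drop; lia.
  by rewrite size_take; case: ifP; lia.
move=> x y xyT; split; exists 0 => //; rewrite mem_cat; apply/orP.
  by left; apply/mapP; exists (x, y).
by right; apply/mapP; exists (x, y).
Qed.

Lemma levelS k D : closed D -> level k D ->
  exists E, [/\ size E <= (4 * k + 4) * (2 * size T), closed (E ++ D)
              & level k.+1 (E ++ D)].
Proof.
move=> cD lD.
pose L := [seq last_k (2 ^ k.+1) p.1 | p <- T] ++ [seq take (2 ^ k.+1) p.2 | p <- T].
have join D' u f v z : closed D' -> level k D' -> cut_factor f -> size f <= 2 ^ k ->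
    z = u ++ v -> ((u = f /\ below D' k.*2.+1 v) \/ (v = f /\ below D' k.*2.+1 u)) ->
    exists E, [/\ size E <= 4 * k + 4, closed (E ++ D') & below (E ++ D') k.+1.*2.+1 z].
  move=> cD' lD' ff sf -> uv; have [E [sE cE fE]] := below_factor cD' lD' ff sf.
  have [uE vE] : below (E ++ D') k.*2.+2 u /\ below (E ++ D') k.*2.+2 v.
    case: uv => -[-> b]; split=> //; apply: below_cat;
    by apply: belowW b.
  (* An empty part is not allowed in a derivation; [z] is then the other part and needs no entry of
     its own. *)
  case: (posnP (size u)) => [/size0nil ->|u0].
    exists E; split=> //; [lia|]; by apply: belowW vE => //; lia.
  case: (posnP (size v)) => [/size0nil ->|v0].
    rewrite cats0; exists E; split=> //; [lia|]; by apply: belowW uE => //; lia.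
  exists ((u ++ v, k.*2.+2) :: E); split; [by rewrite /=; lia| |].
    by apply: closed_cons => //; right; exists u, v.
  by rewrite doubleS; apply: below_head.
have stepL z D' : z \in L -> level k D' -> closed D' ->
    exists E, [/\ size E <= 4 * k + 4, closed (E ++ D') & below (E ++ D') k.+1.*2.+1 z].
  move=> zL lD' cD'; move: zL; rewrite mem_cat => /orP[] /mapP[[x y] xyT ->] /=.
    have [xD _] := lD' _ _ xyT.
    (* Truncated subtraction covers short words: [f] is empty if [x] fits in level [k], and is all
       that precedes the last [2 ^ k] letters if [x] fits in level [k.+1]. *)
    pose f := take (size x - 2 ^ k - (size x - 2 ^ k.+1)) (last_k (2 ^ k.+1) x).
    have E2 : 2 ^ k.+1 = 2 ^ k + 2 ^ k by rewrite expnS; lia.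
    have zE : last_k (2 ^ k.+1) x = f ++ last_k (2 ^ k) x.
      rewrite -{1}(cat_take_drop (size x - 2 ^ k - (size x - 2 ^ k.+1)) (last_k _ x)).
      by congr (_ ++ _); rewrite /last_k drop_drop; congr drop; lia.
    apply: (join D' f f (last_k (2 ^ k) x)) => //; last by left.
      exists x, y, (take (size x - 2 ^ k.+1) x), (last_k (2 ^ k) x ++ y); split=> //.
      by rewrite [f ++ _ ++ _]catA -zE catA cat_take_drop.
    by rewrite /f size_take /last_k size_drop; case: ifP; lia.
  have [_ yD] := lD' _ _ xyT.
  pose f := drop (2 ^ k) (take (2 ^ k.+1) y).
  have E2 : 2 ^ k.+1 = 2 ^ k + 2 ^ k by rewrite expnS; lia.
  have zE : take (2 ^ k.+1) y = take (2 ^ k) y ++ f.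
    rewrite -{1}(cat_take_drop (2 ^ k) (take (2 ^ k.+1) y)) take_takel //; lia.
  apply: (join D' (take (2 ^ k) y) f f) => //; last by right.
    exists x, y, (x ++ take (2 ^ k) y), (drop (2 ^ k.+1) y); split=> //.
    by rewrite -catA [_ ++ f ++ _]catA -zE cat_take_drop.
  by rewrite /f size_drop size_take; case: ifP; lia.
have [E [sE cE LE]] := below_all (@level_cat k) lD cD stepL.
exists E; split=> //; first by move: sE; rewrite /L size_cat !size_map; lia.
move=> x y xyT; split; apply: LE; rewrite mem_cat; apply/orP.
  by left; apply/mapP; exists (x, y).
by right; apply/mapP; exists (x, y).
Qed.

(** Going from level [j] to [j.+1] costs [4 * j + 4] for each of [2 * size T] words; summed over
    [j < k] this is [2 * k * k.+1], and the extra 1 is level 0. *)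
Lemma level_exists k :
  exists D, [/\ size D <= 2 * size T * (2 * k * k.+1).+1, closed D & level k D].
Proof.
elim: k => [|k [D [sD cD lD]]].
  have [D [sD cD lD]] := level0; exists D; split=> //; lia.
have [E [sE cE lE]] := levelS cD lD; exists (E ++ D); split=> //.
rewrite size_cat; apply: leq_trans (leq_add sE sD) _.
by rewrite [_ * (2 * size T)]mulnC -mulnDr leq_mul2l; apply/orP; right; nia.
Qed.

Lemma grammar_exists k (L : seq (seq A)) :
  (forall f, f \in L -> cut_factor f /\ size f <= 2 ^ k) ->
  exists D, [/\ size D <= 2 * size T * (2 * k * k.+1).+1 + (4 * k + 3) * size L,
                closed D & forall f, f \in L -> exists h, (f, h) \in D].
Proof.
move=> Lf; have [D [sD cD lD]] := level_exists k.
have [|E [sE cE LE]] :=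
  @below_all _ (level k) L (4 * k + 3) k.*2.+2 D (@level_cat k) lD cD.
  by move=> f D' /Lf[ff sf] lD' cD'; apply: below_factor.
exists (E ++ D); split=> //; first by rewrite size_cat addnC leq_add.
by move=> f /LE[h _ fD]; exists h.
Qed.

End CutWords.

(** * From closed families of words to straight-line programs *)

Section WordsToSLP.
Variables (A : eqType) (ainv : A -> A) (ok : A -> Prop).
Variables (Q : finType) (word : Q -> seq A).

Hypothesis word_split : forall q, size (word q) <= 1 \/
  exists q1 q2, [/\ word q = word q1 ++ word q2, 0 < size (word q1) & 0 < size (word q2)].

Definition split_pair (q : Q) (p : Q * Q) : bool :=
  [&& word q == word p.1 ++ word p.2, 0 < size (word p.1) & 0 < size (word p.2)].

(** Heights are forgotten: any split into nonempty parts will do. Every leaf must satisfy [ok], but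
    no invariant on the letters of auxiliary words is carried along, so a bad letter is turned into
    the empty word. *)
Definition word_rules (q : Q) : rhs A Q :=
  match word q with
  | [::] => Leaf None
  | [:: a] => Leaf (if Defs.decP (ok a) then Some a else None)
  | _ => if [pick p | split_pair q p] is Some p
         then Node (p.1, false) (p.2, false) else Leaf None
  end.

Lemma decP_reflect (X : Prop) : reflect X (Defs.decP X).
Proof. by rewrite /Defs.decP; case: excluded_middle_informative => x; constructor. Qed.

Lemma word_rules_leaf q a : word_rules q = Leaf (Some a) -> ok a.
Proof.
rewrite /word_rules; case: (word q) => [//|b [|c u]].
  by case: decP_reflect => // okb [<-].
by case: pickP.
Qed.

Lemma word_rules_node q y z : word_rules q = Node y z ->
  [/\ split_pair q (y.1, z.1), y.2 = false & z.2 = false].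
Proof.
rewrite /word_rules; case: (word q) => [//|b [|c u]] //.
by case: pickP => // -[p1 p2] sp [<- <-].
Qed.

Lemma word_rules_ordered : slp_ordered word_rules.
Proof.
exists (fun u v => size (word v.1) < size (word u.1)); split; first by move=> v; rewrite ltnn.
split; first by move=> u v x; lia.
move=> q y z /word_rules_node[/and3P[/= /eqP -> y0 z0] _ _].
by rewrite size_cat; split=> /=; lia.
Qed.

(** The fuel is measured by the number of variables with a shorter word. It drops at a child, which
    is counted for its parent but not for itself. *)
Lemma evalF_word n q : (forall a, a \in word q -> ok a) ->
  #|[set p | size (word p) < size (word q)]| < n ->
  evalF ainv word_rules n (q, false) = word q.
Proof.
elim: n q => // n IH q okq qn /=.
case rq: (word_rules q) => [[a|]|y z].
- move: rq; rewrite /word_rules; case: (word q) => [//|b [|c u]].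
    by case: decP_reflect => // _ [->].
  by case: pickP.
- move: rq okq; rewrite /word_rules; case wq: (word q) => [//|b [|c u]].
    by case: decP_reflect => // nb _ /(_ b); rewrite inE eqxx => /(_ isT).
  case: pickP => // np _ _.
  case: (word_split q) => [|[q1 [q2 [e s1 s2]]]]; first by rewrite wq.
  by move: (np (q1, q2)); rewrite /split_pair e eqxx s1 s2.
have [/and3P[/= /eqP wE y0 z0] y2 z2] := word_rules_node rq.
case: y z y2 z2 wE y0 z0 rq => [y b] [z c] /= -> -> wE y0 z0 rq.
have child p : size (word p) < size (word q) ->
    #|[set p' | size (word p') < size (word p)]| < n.
  rewrite ltnS in qn => pq; apply: leq_trans qn; apply: proper_card; apply/properP; split.
    by apply/subsetP => p'; rewrite !inE; lia.
  by exists p; rewrite !inE ?ltnn.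
rewrite wE size_cat in child.
by rewrite wE !IH // => [a aw||a aw|]; (try by apply: child; lia);
  apply: okq; rewrite wE mem_cat aw ?orbT.
Qed.

Lemma eval_word q : (forall a, a \in word q -> ok a) ->
  eval ainv word_rules (q, false) = word q.
Proof. by move=> okq; apply: evalF_word => //; rewrite ltnS max_card. Qed.

End WordsToSLP.

(** * Free intervals and breakpoints *)

Definition ilen (I : interval) := (I.2 - I.1.2) + (I.1.2 - I.2).

(* The [k]-th position met when travelling from the first to the second
   endpoint; this treats both orientations of an interval uniformly. *)
Definition walk (a b k : nat) := if a <= b then a + k else a - k.
Definition pt (I : interval) := walk I.1.2 I.2.
Definition isub (I : interval) (k m : nat) : interval := (I.1.1, pt I k, pt I m).

Lemma isub_full I : isub I 0 (ilen I) = I.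
Proof.
case: I => [[i a] b]; rewrite /isub /pt /walk /ilen /=.
by case: leqP => ab; congr (_, _, _); lia.
Qed.

Lemma pt_surj I c : ilo I < c -> c < ihi I -> exists2 k, 0 < k < ilen I & pt I k = c.
Proof.
move=> loc hic; suff [k []] : exists k, 0 < k < ilen I /\ pt I k = c by exists k.
exists (if I.1.2 <= I.2 then c - I.1.2 else I.1.2 - c).
by move: loc hic; rewrite /ilo /ihi /ilen /pt /walk; case: ifP; lia.
Qed.

Section Breakpoints.
Variables (G : finType) (ginv : G -> G) (P : finType).
Variables (sys : seq (equation P)) (sigma : P -> seq G).
Hypothesis sigma_sol : is_solution ginv sys sigma.

Local Notation n i := (size (w ginv sys sigma i)).
Local Notation occs := (occs ginv sys sigma).
Local Notation is_cut := (is_cut ginv sys sigma).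
Local Notation gen_rel := (gen_rel ginv sys sigma).
Local Notation approx := (approx ginv sys sigma).
Local Notation valid := (valid_interval ginv sys sigma).
Local Notation free := (free ginv sys sigma).
Local Notation maxfree := (maxfree ginv sys sigma).

Lemma size_sol_lit x : size (sol_lit ginv sigma x) = size (sigma x.1).
Proof. by rewrite /sol_lit /winv; case: x.2; rewrite ?size_rev ?size_map. Qed.

Lemma occs_from_bound x l m u : (x, l) \in occs_from ginv sigma m u ->
  l + size (sigma x.1) <= m + size (sol_word ginv sigma u).
Proof.
elim: u m => // y u IH m /=; rewrite inE /sol_word /= size_cat -/(sol_word _ _ _).
case/orP => [/eqP[-> ->]|/IH]; first by rewrite -size_sol_lit; lia.
by rewrite addnA.
Qed.

Lemma occs_bound i x l : i < size sys -> (x, l) \in occs i ->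
  l + size (sigma x.1) <= n i.
Proof.
move=> isys; rewrite mem_cat => /orP[] /occs_from_bound; rewrite add0n //.
by rewrite /w sigma_sol //; apply: mem_nth.
Qed.

Definition occ_pair i l i' l' s o := exists x x',
  [/\ i < size sys, (x, l) \in occs i, i' < size sys & (x', l') \in occs i'] /\
  [/\ x.1 = x'.1, s = size (sigma x.1) & o = (x.2 == x'.2)].

Definition mirror (o : bool) (l s k : nat) := if o then l + k else l + s - k.

Lemma gen_relP I J : gen_rel I J <-> exists i l i' l' s o mu nu,
  [/\ occ_pair i l i' l' s o, mu <= s, nu <= s, I = (i, l + mu, l + nu)
    & J = (i', mirror o l' s mu, mirror o l' s nu)].
Proof.
split.
  move=> [i [x [l [i' [x' [l' [mu [nu [[iS xi i'S xi' xx] [mus [nus [-> ->]]]]]]]]]]]].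
  exists i, l, i', l', (size (sigma x.1)), (x.2 == x'.2), mu, nu; split=> //.
    by exists x, x'.
  by rewrite /mirror; case: eqP.
move=> [i [l [i' [l' [s [o [mu [nu [[x [x' [[iS xi i'S xi'] [xx -> ->]]]] mus nus -> ->]]]]]]]]].
exists i, x, l, i', x', l', mu, nu; do 4 split=> //.
by rewrite /mirror; case: eqP.
Qed.

Lemma occ_pair_sym i l i' l' s o : occ_pair i l i' l' s o -> occ_pair i' l' i l s o.
Proof.
move=> [x [x' [[? ? ? ?] [xx -> ->]]]]; exists x', x; split=> //.
by rewrite xx eq_sym.
Qed.

Lemma occ_pairP i l i' l' s o : occ_pair i l i' l' s o ->
  [/\ i < size sys, l + s <= n i, is_cut i l & is_cut i (l + s)].
Proof.
move=> [x [x' [[? xi ? ?] [xx -> _]]]]; split=> //; first exact: occs_bound.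
  by exists x, l; split=> //; left.
by exists x, l; split=> //; right; rewrite size_sol_lit.
Qed.

Lemma gen_rel_sym I J : gen_rel I J -> gen_rel J I.
Proof.
move/gen_relP=> [i [l [i' [l' [s [o [mu [nu [pr mus nus -> ->]]]]]]]]].
apply/gen_relP; exists i', l', i, l, s, o.
exists (if o then mu else s - mu), (if o then nu else s - nu).
rewrite /mirror; case: o pr => pr; split=> //; rewrite ?leq_subr //;
  try exact: occ_pair_sym; by congr (_, _, _); lia.
Qed.

Lemma gen_rel_valid I J : gen_rel I J -> valid I.
Proof.
move/gen_relP=> [i [l [i' [l' [s [o [mu [nu [pr mus nus -> _]]]]]]]]].
have [iS ls _ _] := occ_pairP pr.
by rewrite /valid_interval /ieq /=; split=> //; split; lia.
Qed.

Lemma gen_rel_sub I J : gen_rel I J -> ilen I = ilen J /\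
  forall k m, k <= ilen I -> m <= ilen I -> gen_rel (isub I k m) (isub J k m).
Proof.
move/gen_relP=> [i [l [i' [l' [s [o [mu [nu [pr mus nus -> ->]]]]]]]]].
rewrite /ilen /mirror /=; split; first by case: o {pr} => /=; lia.
move=> k m kI mI; apply/gen_relP; exists i, l, i', l', s, o.
exists (walk mu nu k), (walk mu nu m); rewrite /isub /pt /walk /=.
by case: o pr => pr; split=> //; rewrite /mirror; repeat case: ifP; try lia;
   move=> *; congr (_, _, _); lia.
Qed.

Lemma gen_rel_swap I J : gen_rel I J -> gen_rel (iswap I) (iswap J).
Proof.
move/gen_relP=> [i [l [i' [l' [s [o [mu [nu [pr mus nus -> ->]]]]]]]]].
by apply/gen_relP; exists i, l, i', l', s, o, nu, mu; split.
Qed.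

Lemma approx_refl I : approx I I.
Proof. exact: rst_refl. Qed.

Lemma approx_sym I J : approx I J -> approx J I.
Proof. exact: rst_sym. Qed.

Lemma approx_trans I J K : approx I J -> approx J K -> approx I K.
Proof. exact: rst_trans. Qed.

Lemma approx_swap I J : approx I J -> approx (iswap I) (iswap J).
Proof.
elim=> [K L /gen_rel_swap|K|K L _|K L M _ KL _]; first exact: rst_step.
- exact: approx_refl.
- exact: approx_sym.
- exact: approx_trans.
Qed.

Lemma approx_valid I J : approx I J -> valid I <-> valid J.
Proof.
elim=> [K L KL|K|K L _|K L M _ KL _ LM] //; last by rewrite KL.
  by split=> _; [apply: (gen_rel_valid (gen_rel_sym KL)) | apply: gen_rel_valid KL].
by case.
Qed.

Lemma approx_sub I J : approx I J -> ilen I = ilen J /\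
  forall k m, k <= ilen I -> m <= ilen I -> approx (isub I k m) (isub J k m).
Proof.
elim=> [K L /gen_rel_sub[KL subKL]|K|K L _ [KL subKL]|K L M _ [KL subKL] _ [LM subLM]].
- by split=> // k m kK mK; apply: rst_step; apply: subKL.
- by split=> // k m _ _; apply: approx_refl.
- by split=> // k m kK mK; apply: approx_sym; apply: subKL; rewrite KL.
- split; first by rewrite KL.
  by move=> k m kK mK; apply: (approx_trans (subKL _ _ kK mK)); apply: subLM; rewrite -KL.
Qed.

Lemma free_approx I J : approx I J -> free I -> free J.
Proof.
move=> IJ [vI fI]; split; first by apply/(approx_valid IJ).
by move=> K KJ; apply: fI; apply: approx_trans KJ (approx_sym IJ).
Qed.

Lemma iswapK : involutive iswap.
Proof. by case=> [[]]. Qed.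

Lemma ilo_swap I : ilo (iswap I) = ilo I. Proof. exact: minnC. Qed.
Lemma ihi_swap I : ihi (iswap I) = ihi I. Proof. exact: maxnC. Qed.

Lemma free_swap I : free I -> free (iswap I).
Proof.
move=> [[iI [aI bI]] fI]; split; first by [].
move=> J JI c cJ; rewrite -ilo_swap -ihi_swap; apply: (fI (iswap J)) cJ.
by rewrite -[I]iswapK; apply: approx_swap.
Qed.

Lemma maxfree_swap I : maxfree I -> maxfree (iswap I).
Proof.
by move=> [fI mI]; split; [apply: free_swap | rewrite ilo_swap ihi_swap].
Qed.

(** Local test for the endpoints of maximal free intervals. The two ends of [w_i] are put in by
    hand, having no length-two interval around them. *)
Definition brk i p := [|| p == 0, p == n i | ~~ Defs.decP (free (i, p.-1, p.+1))].

Lemma cut_brk i p : is_cut i p -> brk i p.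
Proof.
move=> ci; apply/or3P; case: (posnP p) => [->|p0]; first by constructor 1.
constructor 3; apply/decP_reflect => -[_ /(_ _ (approx_refl _) _ ci)].
by rewrite /ilo /ihi /=; lia.
Qed.

(** At an end of the variable occurrence both positions are cuts. Strictly inside, the length-two
    interval stays within the occurrence and is carried along with it. *)
Lemma gen_rel_brk I J k : gen_rel I J -> k <= ilen I ->
  brk I.1.1 (pt I k) = brk J.1.1 (pt J k).
Proof.
move/gen_relP=> [i [l [i' [l' [s [o [mu [nu [pr mus nus -> ->]]]]]]]]] /= kI.
set c := walk mu nu k.
have cs : c <= s by move: kI; rewrite /c /walk /ilen /=; case: ifP; lia.
have -> : pt (i, l + mu, l + nu) k = l + c.
  by move: kI; rewrite /c /pt /walk /ilen /= leq_add2l; case: ifP; lia.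
have -> : pt (i', mirror o l' s mu, mirror o l' s nu) k = mirror o l' s c.
  move: kI; rewrite /c /pt /walk /ilen /mirror /=.
  by case: (o); repeat case: ifP; lia.
have [iS ls cl cls] := occ_pairP pr.
have [i'S l's cl' cls'] := occ_pairP (occ_pair_sym pr).
case: (posnP c) => [->|c0].
  by rewrite addn0 (cut_brk cl) /mirror; case: (o); rewrite ?addn0 ?subn0 cut_brk.
case: (ltngtP c s) cs => // [cs _|-> _]; last first.
  by rewrite (cut_brk cls) /mirror; case: (o); rewrite ?addnK cut_brk.
rewrite /brk (_ : (l + c == 0) = false) 1?(_ : (l + c == n i) = false); try lia.
rewrite (_ : (mirror o l' s c == 0) = false) 1?(_ : (mirror o l' s c == n i') = false) /=;
  try by rewrite /mirror; case: (o); lia.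
congr (~~ _).
have g : gen_rel (i, (l + c).-1, (l + c).+1)
   (if o then (i', (mirror o l' s c).-1, (mirror o l' s c).+1)
    else iswap (i', (mirror o l' s c).-1, (mirror o l' s c).+1)).
  apply/gen_relP; exists i, l, i', l', s, o, c.-1, c.+1; split=> //; try lia.
    by congr (_, _, _); lia.
  by rewrite /mirror /iswap; case: (o); congr (_, _, _) => /=; lia.
have ga := rst_step _ _ _ _ g.
have fE : free (i, (l + c).-1, (l + c).+1) <->
          free (i', (mirror o l' s c).-1, (mirror o l' s c).+1).
  case: (o) ga => ga; split.
  - exact: free_approx.
  - exact: free_approx (approx_sym ga).
  - by move/(free_approx ga)/free_swap; rewrite iswapK.
  - by move/free_swap; apply: free_approx (approx_sym ga).
by apply/decP_reflect/decP_reflect => /fE.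
Qed.

Lemma approx_brk I J k : approx I J -> k <= ilen I ->
  brk I.1.1 (pt I k) = brk J.1.1 (pt J k).
Proof.
move=> IJ; elim: IJ k => [K L KL|K|K L KL IH|K L M KL IH _ IH'] k kI //.
- exact: gen_rel_brk.
- by rewrite IH //; have [-> _] := approx_sub KL.
- by rewrite IH // IH' //; have [<- _] := approx_sub KL.
Qed.

(* A free interval has no cut inside, so it lies in every variable occurrence
   that contains a nonempty part of it and is carried along with that part. *)
Lemma free_lift S S' I k m : approx S S' -> free I -> k < m <= ilen I ->
  S = isub I k m -> exists2 I', approx I I' & S' = isub I' k m.
Proof.
suff lift : approx S S' ->
    (forall I, free I -> k < m <= ilen I -> S = isub I k m ->
       exists2 I', approx I I' & S' = isub I' k m) /\
    (forall I, free I -> k < m <= ilen I -> S' = isub I k m ->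
       exists2 I', approx I I' & S = isub I' k m).
  by move=> /lift[SS' _]; apply: SS'.
have step K L : gen_rel K L -> forall I, free I -> k < m <= ilen I -> K = isub I k m ->
    exists2 I', approx I I' & L = isub I' k m.
  move=> KL [[i a] b] [vI fI] km KE; rewrite {}KE in KL.
  move/gen_relP: KL => [j [l [i' [l' [s [o [mu [nu [pr mus nus]]]]]]]]].
  rewrite /isub /= => -[jE lmu lnu LE]; subst j.
  have [iS ls cl cls] := occ_pairP pr.
  have fl := fI _ (approx_refl _) l cl; have fls := fI _ (approx_refl _) (l + s) cls.
  have [a1 b1 a2 b2] : [/\ l <= a, l <= b, a <= l + s & b <= l + s].
    move: fl fls lmu lnu km; rewrite /ilo /ihi /ilen /pt /walk /=.
    by case: ifP => ab *; split; lia.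
  exists (i', mirror o l' s (a - l), mirror o l' s (b - l)).
    apply: rst_step; apply/gen_relP; exists i, l, i', l', s, o, (a - l), (b - l).
    by split=> //; [lia | lia | congr (_, _, _); lia].
  rewrite LE; move: lmu lnu km; rewrite /ilen /pt /walk /mirror /=.
  by case: (o); repeat case: ifP; move=> *; congr (_, _, _); lia.
elim=> [K L KL|K|K L _ [KL LK]|K L M KL [KL' LK] LM [LM' ML]].
- by split; apply: step => //; apply: gen_rel_sym.
- by split=> J fJ kJ KE; exists J => //; apply: approx_refl.
- by split.
split=> J fJ kJ /[dup] KE.
  move/KL' => /(_ fJ kJ)[J' JJ' LE].
  have [|J'' JJ'' ME] := LM' J' (free_approx JJ' fJ) _ LE.
    by have [<- _] := approx_sub JJ'.
  by exists J'' => //; apply: approx_trans JJ' JJ''.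
move/ML => /(_ fJ kJ)[J' JJ' LE].
have [|J'' JJ'' ME] := LK J' (free_approx JJ' fJ) _ LE.
  by have [<- _] := approx_sub JJ'.
by exists J'' => //; apply: approx_trans JJ' JJ''.
Qed.

(** Freeness is local. A cut inside a copy of a length-two part lifts, by [free_lift], to a cut
    inside a copy of the whole; conversely, a cut inside a copy of the whole is the midpoint of a
    copy of a length-two part. *)
Lemma free_brkP i a b : i < size sys -> a <= b <= n i ->
  free (i, a, b) <-> forall p, a < p < b -> ~~ brk i p.
Proof.
move=> iS abn; have vI : valid (i, a, b) by rewrite /valid_interval /ieq /=; lia.
split=> [fI p pab|nb].
  rewrite /brk !negb_or negbK; apply/and3P; split; try lia.
  apply/decP_reflect; split; first by rewrite /valid_interval /ieq /=; lia.
  move=> J /approx_sym pJ c cJ.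
  have [||I' II' JE] := @free_lift _ _ (i, a, b) (p.-1 - a) (p.+1 - a) pJ fI.
  - by rewrite /ilen /=; lia.
  - by rewrite /isub /pt /walk /=; case: ifP => *; [congr (_, _, _) | ]; lia.
  have [lenI _] := approx_sub II'; case: fI => _ /(_ _ (approx_sym II') c).
  rewrite JE /isub in cJ *; move=> /(_ cJ); move: lenI.
  rewrite /ilo /ihi /pt /walk /ilen /=.
  by case: ifP; lia.
split=> // J /approx_sym IJ c cJ [loc hic].
have [lenJ subJ] := approx_sub IJ.
have [k kJ kE] := pt_surj loc hic.
have kab : a < a + k < b by move: kJ lenJ; rewrite /ilen /=; lia.
have subk : isub (i, a, b) k.-1 k.+1 = (i, (a + k).-1, (a + k).+1).
  by rewrite /isub /pt /walk /=; case: ifP => ?; [congr (_, _, _)|]; lia.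
have {}subJ : approx (isub J k.-1 k.+1) (i, (a + k).-1, (a + k).+1).
  by rewrite -subk; apply: approx_sym; apply: subJ; lia.
have := nb _ kab; rewrite /brk !negb_or negbK => /and3P[_ _ /decP_reflect[_ fk]].
apply: (fk _ subJ c cJ); move: kE kJ.
by rewrite /ilo /ihi /isub /pt /walk /ilen /=; case: ifP; lia.
Qed.

(** An endpoint that is no breakpoint would allow an extension by one position; an endpoint that is
    one lies strictly inside any larger interval extending past it. *)
Lemma maxfree_brkP i a b : i < size sys -> a < b <= n i ->
  maxfree (i, a, b) <-> [/\ brk i a, brk i b & forall p, a < p < b -> ~~ brk i p].
Proof.
move=> iS ab; have abW : a <= b <= n i by lia.
split=> [[fI mI]|[ba bb nb]].
  have nb := (free_brkP iS abW).1 fI.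
  split=> //; apply/negPn/negP => nbrk; apply: mI.
    have a0 : a != 0 by apply: contraNN nbrk => /eqP->; rewrite /brk eqxx.
    exists (i, a.-1, b); rewrite /ieq /ilo /ihi /=; split; last by lia.
    apply/free_brkP => // [|p pab]; first lia.
    by case: (eqVneq p a) => [->//|pa]; apply: nb; lia.
  have bn : b != n i by apply: contraNN nbrk => /eqP->; rewrite /brk eqxx orbT.
  exists (i, a, b.+1); rewrite /ieq /ilo /ihi /=; split; last by lia.
  apply/free_brkP => // [|p pab]; first lia.
  by case: (eqVneq p b) => [->//|pa]; apply: nb; lia.
split; first exact/free_brkP.
move=> [J [fJ [iJ [loJ [hiJ lenJ]]]]].
have {}fJ : free (i, ilo J, ihi J).
  case: J fJ iJ {loJ hiJ lenJ} => [[j c] d] fJ; rewrite /ieq /ilo /ihi /= => <-.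
  by case: (leqP c d) => _ //; apply: free_swap fJ.
have JN : ilo J <= ihi J <= n i.
  by case: fJ => -[_ [_]]; rewrite /ieq /= => -> _; rewrite andbT /ilo /ihi; lia.
have nJ := (free_brkP iS JN).1 fJ.
rewrite /ilo /ihi /= in loJ hiJ lenJ nJ *.
have [|] : a <> minn J.1.2 J.2 \/ b <> maxn J.1.2 J.2 by lia.
  by move=> an; move: (nJ a); rewrite ba; lia.
by move=> bn; move: (nJ b); rewrite bb; lia.
Qed.

Lemma maxfree_pair i a b : i < size sys -> a < b <= n i -> brk i a -> brk i b ->
  (forall p, a < p < b -> ~~ brk i p) -> maxfree (i, a, b) /\ maxfree (i, b, a).
Proof.
move=> iS ab ba bb nb; have mI : maxfree (i, a, b) by apply/maxfree_brkP.
by split=> //; apply: maxfree_swap mI.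
Qed.

(** For an empty [w_i] the two sides differ: [bp] asks for a nonempty maximal free interval and is
    empty, whereas 0 satisfies [brk]. *)
Lemma bpE i : i < size sys -> 0 < n i ->
  bp ginv sys sigma i = [seq p <- iota 0 (n i).+1 | brk i p].
Proof.
move=> iS n0; apply: eq_in_filter => p; rewrite mem_iota add0n => /andP[_ pn].
rewrite ltnS in pn.
apply/decP_reflect/idP => [[b [bp mI]]|bp].
  have bn : b <= n i by case: mI => -[[_ [_ ?]] _] _.
  case: (ltngtP b p) bp => // bp _.
    have bpn : b < p <= n i by rewrite bp.
    by have [_ ->] := (maxfree_brkP iS bpn).1 (maxfree_swap mI).
  have pbn : p < b <= n i by rewrite bp.
  by have [->] := (maxfree_brkP iS pbn).1 mI.
have brk0 : brk i 0 by rewrite /brk eqxx.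
have brkn : brk i (n i) by rewrite /brk eqxx orbT.
case: (ltnP p (n i)) => pn'.
  have ex : exists q, (p < q) && brk i q by exists (n i); rewrite pn'.
  case: (ex_minnP ex) => q /andP[pq bq] qmin; exists q; split; first lia.
  have qn : q <= n i by apply: qmin; rewrite pn'.
  apply: (maxfree_pair iS _ bp bq _).1 => [|r rq]; first by rewrite pq.
  by apply/negP => br; move: (qmin r); rewrite br; lia.
have ex : exists q, (q < p) && brk i q by exists 0; rewrite brk0 andbT; lia.
have bound q : (q < p) && brk i q -> q <= p by lia.
case: (ex_maxnP ex bound) => q /andP[qp bq] qmax; exists q; split; first lia.
apply: (maxfree_pair iS _ bq bp _).2 => [|r rq]; first by rewrite qp.
by apply/negP => br; move: (qmax r); rewrite br; lia.
Qed.

End Breakpoints.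

(** * Words of classes of maximal free intervals *)

Lemma consec_map (f : nat -> nat) s :
  consec (map f s) = [seq (f p.1, f p.2) | p <- consec s].
Proof. by elim: s => [|a [|b s] IH] //=; congr (_ :: _). Qed.

Lemma consec_cat s1 c s2 :
  consec (s1 ++ c :: s2) = consec (rcons s1 c) ++ consec (c :: s2).
Proof. by elim: s1 => [|a [|b s] IH] //=; congr (_ :: _). Qed.

Lemma consec_rev s : consec (rev s) = rev [seq (p.2, p.1) | p <- consec s].
Proof.
elim: s => [|a [|b s] IH] //.
rewrite rev_cons [rev (b :: s)]rev_cons -cats1 cat_rcons consec_cat.
by rewrite -rev_cons IH /= rev_cons -cats1.
Qed.

Lemma size_consec s : size (consec s) = (size s).-1.
Proof. by elim: s => [|a [|b s] IH] //; move: IH => /= ->. Qed.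

Lemma consec_filter_iota (p : pred nat) m k a b :
  (a, b) \in consec [seq c <- iota m k | p c] ->
  [/\ m <= a, a < b < m + k, p a, p b & forall c, a < c < b -> ~~ p c].
Proof.
elim: k m => // k IH m /=.
have head m' k' c s : [seq c <- iota m' k' | p c] = c :: s ->
    [/\ m' <= c < m' + k', p c & forall d, m' <= d < c -> ~~ p d].
  elim: k' m' => // k' IHk m' /=; case: ifP => pm'.
    by move=> [<- _]; split=> // [|d]; lia.
  move=> /IHk[? ? nd]; split=> // [|d dm]; first lia.
  by case: (eqVneq d m') => [->|dm']; [rewrite pm' | apply: nd; lia].
case: ifP => pm; last by case/IH => ? ? ? ? ?; split=> //; lia.
case Es: [seq c <- iota m.+1 k | p c] => [//|c s].
rewrite (_ : consec [:: m, c & s] = (m, c) :: consec (c :: s)) // inE => /orP[/eqP[-> ->]|].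
  by have [? ? nd] := head _ _ _ _ Es; split=> //; lia.
by rewrite -Es => /IH[? ? ? ? ?]; split=> //; lia.
Qed.

Lemma isub_isub I k m a b : k <= m <= ilen I -> a <= m - k -> b <= m - k ->
  isub (isub I k m) a b = isub I (k + a) (k + b).
Proof.
move=> km am bm; move: km; rewrite /isub /pt /walk /ilen /=.
by repeat case: ifP; move=> *; congr (_, _, _); lia.
Qed.

Lemma pt_isub I k m a : k <= m <= ilen I -> a <= m - k ->
  pt (isub I k m) a = pt I (k + a).
Proof. by move=> km am; have [] := isub_isub km am am. Qed.

Lemma ilen_isub I k m : k <= m <= ilen I -> ilen (isub I k m) = m - k.
Proof. by rewrite /isub /pt /walk /ilen /=; case: ifP; lia. Qed.

Section GenericWords.
Variables (G : finType) (ginv : G -> G) (P : finType).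
Variables (sys : seq (equation P)) (sigma : P -> seq G).
Hypothesis sigma_sol : is_solution ginv sys sigma.

Local Notation n i := (size (w ginv sys sigma i)).
Local Notation occs := (occs ginv sys sigma).
Local Notation is_cut := (is_cut ginv sys sigma).
Local Notation approx := (approx ginv sys sigma).
Local Notation valid := (valid_interval ginv sys sigma).
Local Notation free := (free ginv sys sigma).
Local Notation maxfree := (maxfree ginv sys sigma).
Local Notation brk := (brk ginv sys sigma).
Local Notation all_occs := (all_occs ginv sys sigma).

(** Breakpoints are recorded as offsets in travel order, so that equivalent intervals have equal
    lists whatever their place and orientation. *)
Definition ticks I := [seq k <- iota 0 (ilen I).+1 | brk I.1.1 (pt I k)].
Definition units I := [seq isub I p.1 p.2 | p <- consec (ticks I)].

(* A representative that depends only on the class of a maximal free interval. *)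
Definition rep (I : interval) : interval :=
  choose (fun J => Defs.decP (maxfree J /\ approx J I)) I.
Definition gword I := map rep (units I).

Lemma repP I : maxfree I -> maxfree (rep I) /\ approx (rep I) I.
Proof.
move=> mI; apply/decP_reflect.
apply: (chooseP (P := fun J => Defs.decP (maxfree J /\ approx J I))).
by apply/decP_reflect; split=> //; apply: approx_refl.
Qed.

Lemma rep_eq I J : maxfree I -> maxfree J -> approx I J -> rep I = rep J.
Proof.
move=> mI mJ IJ; rewrite /rep.
have E : (fun K => Defs.decP (maxfree K /\ approx K I)) =1
         (fun K => Defs.decP (maxfree K /\ approx K J)).
  move=> K; apply/decP_reflect/decP_reflect => -[mK KI]; split=> //.
    exact: approx_trans KI IJ.
  exact: approx_trans KI (approx_sym IJ).
rewrite (eq_choose E); apply: choose_id; apply/decP_reflect; split=> //.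
exact: approx_refl.
Qed.

Lemma mem_ticks I k : k \in ticks I = (k <= ilen I) && brk I.1.1 (pt I k).
Proof. by rewrite mem_filter mem_iota add0n ltnS andbC. Qed.

Lemma ticks_uniq I : uniq (ticks I).
Proof. by rewrite filter_uniq ?iota_uniq. Qed.

Lemma tick_maxfree I p : valid I -> p \in consec (ticks I) ->
  [/\ p.1 <= ilen I, p.2 <= ilen I & maxfree (isub I p.1 p.2)].
Proof.
case: I p => [[i a] b] [k m] [/= iS [aN bN]] /consec_filter_iota.
rewrite /ieq /= in iS aN bN *; rewrite /isub /=.
case=> _ km bk bm nb; split; [lia..|].
move: km bk bm nb; rewrite /pt /walk /ilen /=; case: (leqP a b) => ab km bk bm nb.
  apply: (maxfree_pair sigma_sol iS _ bk bm _).1; first lia.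
  by move=> p pkm; rewrite (_ : p = a + (p - a)); [apply: nb|]; lia.
apply: (maxfree_pair sigma_sol iS _ bm bk _).2; first lia.
by move=> p pkm; rewrite (_ : p = a - (a - p)); [apply: nb|]; lia.
Qed.

Lemma units_maxfree I J : valid I -> J \in units I -> maxfree J.
Proof. by move=> vI /mapP[p /(tick_maxfree vI)[_ _ ?] ->]. Qed.

(** The offsets of the breakpoints agree, and units at equal offsets are equivalent, hence share
    their representative. This lets a word be replaced by its copy at a cut. *)
Lemma gword_approx I J : valid I -> approx I J -> gword I = gword J.
Proof.
move=> vI IJ; have vJ : valid J by apply/(approx_valid sigma_sol IJ).
have [lenIJ subIJ] := approx_sub IJ.
have tE : ticks I = ticks J.
  rewrite /ticks -lenIJ; apply: eq_in_filter => k; rewrite mem_iota add0n ltnS => kI.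
  exact: approx_brk.
rewrite /gword /units -!map_comp -tE; apply/eq_in_map => p pI /=.
have [p1 p2 mI] := tick_maxfree vI pI.
by rewrite tE in pI; have [_ _ mJ] := tick_maxfree vJ pI; apply: rep_eq => //; apply: subIJ.
Qed.

Lemma ticks_cat I k : k <= ilen I -> brk I.1.1 (pt I k) ->
  exists s, [/\ ticks (isub I 0 k) = rcons s k,
                s = [seq j <- iota 0 k | brk I.1.1 (pt I j)] &
                ticks I = s ++ map (addn k) (ticks (isub I k (ilen I)))] /\
            exists s', map (addn k) (ticks (isub I k (ilen I))) = k :: s'.
Proof.
move=> kI bk; exists [seq j <- iota 0 k | brk I.1.1 (pt I j)].
have tE : map (addn k) (ticks (isub I k (ilen I)))
        = [seq j <- iota k (ilen I - k).+1 | brk I.1.1 (pt I j)].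
  rewrite -[X in iota X](addn0 k) iotaDl filter_map /ticks ilen_isub; last lia.
  congr map; apply: eq_in_filter => j; rewrite mem_iota add0n ltnS => jI /=.
  by rewrite pt_isub //; lia.
split; last by rewrite tE /= bk; eexists.
split=> //.
  rewrite /ticks ilen_isub ?subn0 // -addn1 iotaD filter_cat /= add0n.
  rewrite pt_isub ?subn0 //= add0n bk cats1; congr rcons.
  apply: eq_in_filter => j; rewrite mem_iota add0n => jk.
  by rewrite pt_isub ?subn0 ?add0n //; lia.
by rewrite tE /ticks (_ : (ilen I).+1 = k + (ilen I - k).+1) ?iotaD ?filter_cat //; lia.
Qed.

Lemma units_cat I k : k <= ilen I -> brk I.1.1 (pt I k) ->
  units I = units (isub I 0 k) ++ units (isub I k (ilen I)).
Proof.
move=> kI bk; have [s [[t1 _ t2] [s' t3]]] := ticks_cat kI bk.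
have tb J q : q \in consec (ticks J) -> q.1 <= ilen J /\ q.2 <= ilen J.
  by case: q => a b /consec_filter_iota[*]; split=> /=; lia.
rewrite /units t2 t3 consec_cat map_cat -t1 -t3 consec_map -map_comp.
congr (_ ++ _); apply/eq_in_map => q /tb; rewrite ilen_isub ?subn0; try lia.
  by case=> *; rewrite isub_isub ?subn0 ?add0n //; lia.
by case=> * /=; rewrite isub_isub //; lia.
Qed.

Lemma gword_cat I k : k <= ilen I -> brk I.1.1 (pt I k) ->
  gword I = gword (isub I 0 k) ++ gword (isub I k (ilen I)).
Proof. by move=> kI bk; rewrite /gword -map_cat -units_cat. Qed.

Lemma size_gword I : size (gword I) = (size (ticks I)).-1.
Proof. by rewrite !size_map size_consec. Qed.

(** Offset 0 is a tick, so the unit after [u] starts at tick number [size u]; as ticks are distinct,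
    exactly [size u] letters precede it. *)
Lemma gword_split I u v : brk I.1.1 I.1.2 -> gword I = u ++ v ->
  exists k, [/\ k <= ilen I, brk I.1.1 (pt I k), u = gword (isub I 0 k)
              & v = gword (isub I k (ilen I))].
Proof.
move=> b0 E.
have t0 : 0 \in ticks I.
  by rewrite mem_ticks /= /pt /walk; case: ifP => _; rewrite ?addn0 ?subn0.
have szu : size u < size (ticks I).
  have := congr1 size E; rewrite size_gword size_cat.
  by case: (ticks I) t0 => //= a s _; lia.
pose k := nth 0 (ticks I) (size u).
have kt : k \in ticks I by apply: mem_nth.
move: (kt); rewrite mem_ticks => /andP[kI bk].
have [s [[t1 sE t2] [s' t3]]] := ticks_cat kI bk.
have su : size u = size s.
  have ks : k \notin s by rewrite sE mem_filter mem_iota add0n ltnn !andbF.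
  rewrite -(index_uniq 0 szu (ticks_uniq I)) -/k t2 index_cat (negPf ks) t3 /= eqxx.
  by rewrite addn0.
exists k; move: E; rewrite (gword_cat kI bk) => /eqP.
rewrite eqseq_cat; last by rewrite size_gword t1 size_rcons su.
by move=> /andP[/eqP-> /eqP->]; split.
Qed.

Lemma gword_factor I u f v : brk I.1.1 I.1.2 -> gword I = u ++ f ++ v ->
  exists k m, [/\ k <= m <= ilen I, brk I.1.1 (pt I k), brk I.1.1 (pt I m)
                & f = gword (isub I k m)].
Proof.
move=> b0 /(gword_split b0)[k [kI bk _ /esym E]].
have [m [mI bm fE _]] := gword_split (I := isub I k (ilen I)) bk E.
rewrite ilen_isub in mI; last lia.
exists k, (k + m); rewrite fE isub_isub ?addn0 //; try lia.
by split=> //; [lia | rewrite -(@pt_isub I k (ilen I)) //; lia].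
Qed.

Lemma gword_gt0 I : brk I.1.1 I.1.2 -> brk I.1.1 I.2 -> 0 < ilen I -> 0 < size (gword I).
Proof.
move=> b1 b2 I0; rewrite size_gword; suff : 2 <= size (ticks I) by lia.
apply: (@uniq_leq_size _ [:: 0; ilen I]) => [|k].
  by rewrite /= inE; lia.
rewrite !inE mem_ticks => /orP[] /eqP->.
  by move: b1; rewrite -{1 2}(isub_full I) /=.
by move: b2; rewrite -{1 2}(isub_full I) /= leqnn.
Qed.

Lemma free_tick I k : valid I -> free I -> 0 < k < ilen I -> ~~ brk I.1.1 (pt I k).
Proof.
case: I => [[i a] b] [iS [aN bN]] fI; rewrite /ieq /ilen /pt /walk /= in iS aN bN *.
case: (leqP a b) => ab kI.
  by apply: ((free_brkP sigma_sol iS _).1 fI); lia.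
have {}fI : free (i, b, a) := free_swap fI.
by apply: ((free_brkP sigma_sol iS _).1 fI); lia.
Qed.

(* The factors on both sides of the cut are nonempty, being delimited by
   distinct breakpoints. *)
Lemma gword_cross I : valid I -> brk I.1.1 I.1.2 -> brk I.1.1 I.2 -> 1 < size (gword I) ->
  exists J k, [/\ valid J, 0 < k < ilen J, is_cut J.1.1 (pt J k) & gword I = gword J] /\
    [/\ 0 < size (gword (isub J 0 k)), 0 < size (gword (isub J k (ilen J))),
        brk J.1.1 J.1.2 & brk J.1.1 J.2].
Proof.
move=> vI b1 b2 szI.
have [k kI bk] : exists2 k, 0 < k < ilen I & brk I.1.1 (pt I k).
  case: (boolP (has (fun k => 0 < k < ilen I) (ticks I))) => [/hasP[k]|/hasPn nk].
    by rewrite mem_ticks => /andP[_ bk] kI; exists k.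
  (* Without an inner tick there are at most two ticks, hence at most one letter. *)
  have : size (ticks I) <= size [:: 0; ilen I].
    apply: uniq_leq_size (ticks_uniq I) _ => k kt; have := nk k kt.
    by rewrite mem_ticks in kt; rewrite !inE; lia.
  by rewrite size_gword in szI; move=> /=; lia.
(* An inner breakpoint excludes freeness of [I], which means precisely that some copy of [I] has a
   cut strictly inside. *)
have [J [JI [c [cJ loc hic]]]] : exists J, approx J I /\
    exists c, [/\ is_cut (ieq J) c, ilo J < c & c < ihi J].
  apply: NNPP => nJ; move: (free_tick (k := k) vI); rewrite bk => fI.
  suff /fI/(_ kI) : free I by [].
  split=> // J JI c cJ [loc hic]; apply: nJ; exists J; split=> //; exists c; split=> //.
have IJ := approx_sym JI; have [lenIJ _] := approx_sub IJ.
have vJ : valid J by apply/(approx_valid sigma_sol IJ).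
have [b1' b2'] : brk J.1.1 J.1.2 /\ brk J.1.1 J.2.
  rewrite -[in J.1.2](isub_full J) -[in J.2](isub_full J) /= -lenIJ.
  rewrite -!(approx_brk sigma_sol IJ) //.
  by move: b1 b2; rewrite -[in I.1.2](isub_full I) -[in I.2](isub_full I).
have [m mJ mE] := pt_surj loc hic.
have bm : brk J.1.1 (pt J m) by rewrite mE; apply: cut_brk.
exists J, m; split; first by split=> //; [rewrite mE | apply: gword_approx].
have J0 : pt J 0 = J.1.2 by rewrite -[in RHS](isub_full J).
have Jl : pt J (ilen J) = J.2 by rewrite -[in RHS](isub_full J).
by split=> //; apply: gword_gt0; rewrite ?ilen_isub /= ?J0 ?Jl //; lia.
Qed.

End GenericWords.

(** * The words on both sides of the cuts *)

Section CutWordsOfSystem.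
Variables (G : finType) (ginv : G -> G) (P : finType).
Variables (sys : seq (equation P)) (sigma : P -> seq G).
Hypothesis sigma_sol : is_solution ginv sys sigma.

Local Notation n i := (size (w ginv sys sigma i)).
Local Notation occs := (occs ginv sys sigma).
Local Notation is_cut := (is_cut ginv sys sigma).
Local Notation approx := (approx ginv sys sigma).
Local Notation valid := (valid_interval ginv sys sigma).
Local Notation maxfree := (maxfree ginv sys sigma).
Local Notation brk := (brk ginv sys sigma).
Local Notation all_occs := (all_occs ginv sys sigma).
Local Notation units := (units ginv sys sigma).
Local Notation gword := (gword ginv sys sigma).

Lemma mem_all_occs i o : ((i, o) \in all_occs) = (i < size sys) && (o \in occs i).
Proof.
apply/flatten_mapP/andP => [[j] | [iS oi]].
  by rewrite mem_iota add0n => jS /mapP[o' o'j [-> ->]].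
by exists i; rewrite ?mem_iota //; apply: map_f.
Qed.

Lemma size_all_occs : size all_occs = dlen sys.
Proof.
have size_occs m u : size (occs_from ginv sigma m u) = size u.
  by elim: u m => //= x u IH m; rewrite IH.
rewrite size_flatten /shape -map_comp sumnE big_map /dlen (big_nth ([::], [::])).
rewrite /index_iota subn0; apply: eq_bigr => i _ /=.
by rewrite size_map size_cat !size_occs.
Qed.

Definition cuts : seq (nat * nat) :=
  [seq (o.1, o.2.2) | o <- all_occs] ++
  [seq (o.1, o.2.2 + size (sigma o.2.1.1)) | o <- all_occs].

Lemma mem_cuts i c : (i, c) \in cuts <-> i < size sys /\ is_cut i c.
Proof.
rewrite mem_cat; split.
  case/orP => /mapP[[j [x l]]]; rewrite mem_all_occs /= => /andP[jS xj] [-> ->].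
    by split=> //; exists x, l; split=> //; left.
  by split=> //; exists x, l; split=> //; right; rewrite size_sol_lit.
move=> [iS [x [l [xi cE]]]]; apply/orP; case: cE => ->; [left|right]; apply/mapP;
  by exists (i, (x, l)); rewrite ?mem_all_occs ?iS //= ?size_sol_lit.
Qed.

(** Both directions are stored because a copy crossing a cut may be traversed backwards, and its
    letters are then representatives of swapped intervals. Two ends per occurrence and two
    directions make [4 * dlen sys] pairs. *)
Definition cut_words : seq (seq interval * seq interval) :=
  [seq (gword (p.1, 0, p.2), gword (p.1, p.2, n p.1)) | p <- cuts] ++
  [seq (gword (p.1, n p.1, p.2), gword (p.1, p.2, 0)) | p <- cuts].

Lemma size_cut_words : size cut_words = 4 * dlen sys.
Proof. by rewrite size_cat !size_map size_cat !size_map size_all_occs; lia. Qed.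

Lemma brk0 i : brk i 0. Proof. by rewrite /brk eqxx. Qed.
Lemma brkn i : brk i (n i). Proof. by rewrite /brk eqxx orbT. Qed.

Lemma cut_le i c : i < size sys -> is_cut i c -> c <= n i.
Proof.
move=> iS [x [l [xi cE]]]; have := occs_bound sigma_sol iS xi.
by case: cE => ->; rewrite ?size_sol_lit //; apply: leq_trans; apply: leq_addr.
Qed.

Lemma gword_cat3 i a b c : (a <= b <= c) || (c <= b <= a) -> brk i b ->
  gword (i, a, c) = gword (i, a, b) ++ gword (i, b, c).
Proof.
move=> abc bb; pose k := (b - a) + (a - b).
have kE : pt (i, a, c) k = b by rewrite /pt /walk /k /=; case: ifP; lia.
have kI : k <= ilen (i, a, c) by rewrite /k /ilen /=; lia.
have := gword_cat (ginv := ginv) (sys := sys) (sigma := sigma) kI.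
rewrite kE => /(_ bb) ->; have := isub_full (i, a, c).
by rewrite /isub kE /= => -[-> ->].
Qed.

Lemma cut_words_cat x y : (x, y) \in cut_words ->
  exists i, i < size sys /\ (x ++ y = gword (i, 0, n i) \/ x ++ y = gword (i, n i, 0)).
Proof.
rewrite mem_cat => /orP[] /mapP[[i c] /mem_cuts[iS ci] [-> ->]]; exists i; split=> //=;
  have cn := cut_le iS ci; have bc := cut_brk ci; [left|right];
  by rewrite -gword_cat3 //; lia.
Qed.

Lemma mem_cut_words i a c b : i < size sys -> is_cut i c ->
  a <= n i -> b <= n i -> brk i a -> brk i b -> (a <= c <= b) || (b <= c <= a) ->
  exists x y, (x ++ gword (i, a, c), gword (i, c, b) ++ y) \in cut_words.
Proof.
move=> iS ci an bn ba bb abc; have cn := cut_le iS ci.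
have ic : (i, c) \in cuts by apply/mem_cuts.
case/orP: abc => abc.
  exists (gword (i, 0, a)), (gword (i, b, n i)).
  rewrite -!gword_cat3 //; try lia.
  by rewrite mem_cat; apply/orP; left; apply/mapP; exists (i, c).
exists (gword (i, n i, a)), (gword (i, b, 0)).
rewrite -!gword_cat3 //; try lia.
by rewrite mem_cat; apply/orP; right; apply/mapP; exists (i, c).
Qed.

Lemma cut_factorE f : cut_factor cut_words f ->
  exists I, [/\ valid I, brk I.1.1 I.1.2, brk I.1.1 I.2 & f = gword I].
Proof.
move=> [x [y [u [v [xyT xyE]]]]]; have [i [iS E]] := cut_words_cat xyT.
have [a [b [aN bN ba E']]] : exists a b,
    [/\ a <= n i, b <= n i, brk i a & gword (i, a, b) = u ++ f ++ v].
  case: E; rewrite xyE => ->; [exists 0, (n i) | exists (n i), 0];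
  by split=> //; rewrite ?brk0 ?brkn.
have [k [m [km bk bm ->]]] := gword_factor (I := (i, a, b)) ba E'.
exists (isub (i, a, b) k m); split=> //.
move: km; rewrite /valid_interval /ieq /isub /pt /walk /ilen /=.
by case: ifP => *; split=> //; lia.
Qed.

Lemma cut_words_cross f : cut_factor cut_words f -> 1 < size f ->
  exists x y s t, [/\ (x ++ s, t ++ y) \in cut_words, f = s ++ t, 0 < size s & 0 < size t].
Proof.
move=> /cut_factorE[I [vI b1 b2 ->]] szI.
have [J [k [[vJ kJ ck ->] [s0 t0 b1' b2']]]] := gword_cross sigma_sol vI b1 b2 szI.
case: J vJ kJ ck s0 t0 b1' b2' => [[i a] b] [iS [an bn]] kJ ck s0 t0 ba bb.
rewrite /ieq /= in iS an bn ck ba bb.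
have kE := isub_full (i, a, b); rewrite /isub /= in s0 t0 kE.
case: kE s0 t0 => -> -> s0 t0.
have abc : (a <= pt (i, a, b) k <= b) || (b <= pt (i, a, b) k <= a).
  by move: kJ; rewrite /pt /walk /ilen /=; case: ifP; lia.
have [x [y xyT]] := mem_cut_words iS ck an bn ba bb abc.
exists x, y, (gword (i, a, pt (i, a, b) k)), (gword (i, pt (i, a, b) k, b)).
by split=> //; apply: gword_cat3 => //; apply: cut_brk.
Qed.

(** * The generic solution as words of units, and its length *)

Lemma unitsE I : units I =
  [seq (I.1.1, p.1, p.2) | p <- consec
     [seq q <- [seq pt I k | k <- iota 0 (ilen I).+1] | brk I.1.1 q]].
Proof. by rewrite filter_map consec_map -map_comp. Qed.

Lemma pts_asc i a b : a <= b ->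
  [seq pt (i, a, b) k | k <- iota 0 (ilen (i, a, b)).+1] = iota a (b - a).+1.
Proof.
move=> ab; rewrite -[X in _ = iota X _](addn0 a) iotaDl.
have -> : ilen (i, a, b) = b - a by rewrite /ilen /=; lia.
by apply: eq_map => k; rewrite /pt /walk /= ab.
Qed.

Lemma units_swap I : units (iswap I) = winv iswap (units I).
Proof.
rewrite !unitsE /winv -map_comp.
have -> : [seq pt (iswap I) k | k <- iota 0 (ilen (iswap I)).+1] =
          rev [seq pt I k | k <- iota 0 (ilen I).+1].
  have lenE : ilen (iswap I) = ilen I by rewrite /ilen /iswap /=; lia.
  apply: (@eq_from_nth _ 0); first by rewrite size_rev !size_map lenE.
  move=> k; rewrite lenE size_map size_iota => kI.
  rewrite nth_rev size_map size_iota // !(nth_map 0) ?size_iota; try lia.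
  rewrite !nth_iota; try lia.
  by move: kI; rewrite /pt /walk /ilen /iswap /=; repeat case: ifP; lia.
by rewrite filter_rev consec_rev -!map_rev -map_comp.
Qed.

Lemma units_asc i a b : i < size sys -> a <= b <= n i ->
  units (i, a, b) = [seq (i, p.1, p.2) | p <-
    consec [seq g <- bp ginv sys sigma i | a <= g <= b]].
Proof.
move=> iS abn; rewrite unitsE -[(i, a, b).1.1]/i pts_asc; last lia.
(* For an empty [w_i], where [bpE] fails, both lists of positions have at most one entry and yield
   no unit. *)
have [n0|n0] := posnP (n i).
  have small (s : seq nat) : size s <= 1 -> consec s = [::] by case: s => [|? []].
  have filter1 (p : pred nat) s : size s <= 1 -> size (filter p s) <= 1.
    by rewrite size_filter; apply: leq_trans (count_size _ _).
  by rewrite !small //; do ?apply/filter1; rewrite size_iota; lia.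
congr (map _ (consec _)); rewrite (bpE sigma_sol iS n0).
have -> : (n i).+1 = a + ((b - a).+1 + (n i - b)) by lia.
rewrite !iotaD !filter_cat add0n.
rewrite [X in _ = X ++ _](_ : _ = [::]); last first.
  rewrite -filter_predI; apply/eqP; rewrite -[_ == _]negbK -has_filter.
  by apply/hasPn => q; rewrite mem_iota /=; lia.
rewrite [X in _ = _ ++ _ ++ X](_ : _ = [::]) ?cats0 ?cat0s; last first.
  rewrite -filter_predI; apply/eqP; rewrite -[_ == _]negbK -has_filter.
  by apply/hasPn => q; rewrite mem_iota /=; lia.
rewrite -filter_predI; apply: eq_in_filter => q; rewrite mem_iota /= => qab.
by rewrite (_ : a <= q <= b) //; lia.
Qed.

Lemma var_occurs X : all_vars_occur sys ->
  has (fun o : nat * (lit P * nat) => o.2.1.1 == X) all_occs.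
Proof.
move=> vars; have occ_from u m x : x \in u -> exists l, (x, l) \in occs_from ginv sigma m u.
  elim: u m => // y u IH m; rewrite inE => /orP[/eqP->|/IH].
    by exists m; rewrite /= inE eqxx.
  move=> /(_ (m + size (sol_lit ginv sigma y)))[l xl]; exists l.
  by rewrite /= inE xl orbT.
have [e eS /hasP[x xe xX]] := vars X; apply/hasP.
have [i iS eE] : exists2 i, i < size sys & Defs.eqn sys i = e.
  by exists (index e sys); rewrite ?index_mem // /Defs.eqn nth_index.
have [l xl] : exists l, (x, l) \in occs i.
  by move: xe; rewrite mem_cat => /orP[] /occ_from - /(_ 0)[l xl]; exists l;
    rewrite mem_cat eE xl ?orbT.
by exists (i, (x, l)); rewrite ?mem_all_occs ?iS.
Qed.

Lemma sigma_tildeE X : all_vars_occur sys ->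
  exists i l r, [/\ i < size sys, is_cut i l, is_cut i r
    & sigma_tilde ginv sys sigma X = units (i, l, r)].
Proof.
move=> vars; rewrite /sigma_tilde /first_occ.
set p := (fun o : nat * (lit P * nat) => _); set o := nth _ _ _.
have hasX : has p all_occs by apply: var_occurs.
have oo : o \in all_occs by apply: mem_nth; rewrite -has_find.
case: o oo => i [x l]; rewrite mem_all_occs => /andP[iS xl].
have cl : is_cut i l by exists x, l; split=> //; left.
have cr : is_cut i (l + size (sol_lit ginv sigma x)) by exists x, l; split=> //; right.
have ou : occ_word ginv sys sigma i x l = units (i, l, l + size (sol_lit ginv sigma x)).
  by rewrite units_asc // leq_addr; apply: cut_le.
case: x.2.
  (* For an occurrence of the barred variable, the word is read from right to left. *)
  by exists i, (l + size (sol_lit ginv sigma x)), l; split=> //; rewrite ou -units_swap.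
by exists i, l, (l + size (sol_lit ginv sigma x)); split.
Qed.

Lemma size_cut_factor f : cut_factor cut_words f -> size f <= Ntilde ginv sys sigma.
Proof.
move=> [x [y [u [v [xyT xyE]]]]]; have [i [iS E]] := cut_words_cat xyT.
have : size f <= (size (bp ginv sys sigma i)).-1.
  have -> : (size (bp ginv sys sigma i)).-1 = size (units (i, 0, n i)).
    rewrite units_asc ?leqnn // size_map size_consec; congr (size _).-1.
    symmetry; apply/all_filterP/allP => q; rewrite mem_filter mem_iota; lia.
  have szE : size (x ++ y) = size (units (i, 0, n i)).
    case: E => ->; rewrite /gword size_map // -[(i, n i, 0)]/(iswap (i, 0, n i)).
    by rewrite units_swap size_rev size_map.
  by rewrite -szE xyE !size_cat; lia.
move/leq_trans; apply; rewrite /Ntilde (bigD1 (Ordinal iS)) //=; exact: leq_addr.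
Qed.

Lemma card_vars : all_vars_occur sys -> #|P| <= dlen sys.
Proof.
move=> vars; rewrite -size_all_occs cardE -(size_map (fun o => o.2.1.1) all_occs).
apply: uniq_leq_size (enum_uniq _) _ => X _.
by have /hasP[o oo /eqP <-] := var_occurs X vars; apply: map_f.
Qed.

Lemma cut_factor_sub i l r : i < size sys -> is_cut i l -> is_cut i r ->
  cut_factor cut_words (gword (i, l, r)).
Proof.
move=> iS cl cr; have ln := cut_le iS cl; have rn := cut_le iS cr.
(* With the cut [l] also taken as left end, the word from [l] to [r] becomes a prefix of a word
   stored at [l]. *)
have [x [y]] : exists x y, (x ++ gword (i, l, l), gword (i, l, r) ++ y) \in cut_words.
  by apply: mem_cut_words => //; try exact: cut_brk; lia.
set t := x ++ _ => xyT; exists t, (gword (i, l, r) ++ y), t, y; split=> //.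
Qed.

End CutWordsOfSystem.

Lemma Forall2_map_l (A : eqType) (R : A -> A -> Prop) (f : A -> A) s :
  (forall a, a \in s -> R (f a) a) -> List.Forall2 R (map f s) s.
Proof.
elim: s => [|a s IH] Rs; constructor; first by apply: Rs; rewrite mem_head.
by apply: IH => b bs; apply: Rs; rewrite inE bs orbT.
Qed.

Theorem mainTheorem1 :
  exists C : nat,
  forall (G : finType) (ginv : G -> G), involutive ginv ->
  forall (P : finType) (sys : seq (equation P)) (sigma : P -> seq G),
    all_vars_occur sys ->
    is_solution ginv sys sigma ->
    exists (m : nat) (rules : (P + 'I_m)%type -> rhs interval (P + 'I_m)%type),
      [/\ slp_ordered rules,
          (forall q a, rules q = Leaf (Some a) -> maxfree ginv sys sigma a),
          slp_size rules <=
            C * (dlen sys) ^ 2 * (trunc_log 2 (Ntilde ginv sys sigma)).+1 ^ 2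
        & forall X : P,
            List.Forall2 (approx ginv sys sigma)
              (eval iswap rules (inl X, false))
              (sigma_tilde ginv sys sigma X)].
Proof.
exists 48 => G ginv _ P sys sigma vars sol.
(* The program produces chosen representatives, which is why letters are compared up to [approx]. *)
pose target X := map (rep ginv sys sigma) (sigma_tilde ginv sys sigma X).
set T := cut_words ginv sys sigma; set N := Ntilde ginv sys sigma.
pose K := (trunc_log 2 N).+1.
have targetP f : f \in codom target -> cut_factor T f /\ size f <= 2 ^ K.
  case/codomP => X ->; have [i [l [r [iS cl cr E]]]] := sigma_tildeE sol X vars.
  have ft : cut_factor T (target X) by rewrite /target E; apply: cut_factor_sub.
  split=> //; apply: leq_trans (size_cut_factor sol ft) _.
  by apply: ltnW; apply: trunc_log_ltn.
have [D [szD cD tD]] := grammar_exists (cut_words_cross sol) targetP.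
(* One variable per entry of the grammar, besides those of [P]; repeated words are harmless, since
   rules depend on words only. *)
pose word (q : P + 'I_(size D)) :=
  match q with inl X => target X | inr j => (nth ([::], 0) D j).1 end.
have wordD q : exists h, (word q, h) \in D.
  case: q => [X|j] /=; first by apply: tD; apply: codom_f.
  by exists (nth ([::], 0) D j).2; rewrite -surjective_pairing mem_nth.
have inD f h : (f, h) \in D -> exists q, word q = f.
  move=> fD; have jD : index (f, h) D < size D by rewrite index_mem.
  by exists (inr (Ordinal jD)); rewrite /= nth_index.
have word_split q : size (word q) <= 1 \/ exists q1 q2,
    [/\ word q = word q1 ++ word q2, 0 < size (word q1) & 0 < size (word q2)].
  have [h /cD[|[y [z [E y0 z0 [hy _ /inD[q1 q1E]] [hz _ /inD[q2 q2E]]]]]]] := wordD q.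
    by left.
  by right; exists q1, q2; rewrite q1E q2E.
exists (size D), (word_rules (maxfree ginv sys sigma) word); split.
- exact: word_rules_ordered.
- exact: word_rules_leaf.
- rewrite /slp_size card_sum card_ord; move: szD.
  rewrite size_codom (size_cut_words ginv sys sigma) -/K -/N.
  have := card_vars ginv sigma vars; set d := dlen sys => Pd szD.
  have dd : d <= d ^ 2 by case: (d) => // d'; rewrite expnS leq_pmulr // expn_gt0.
  have K1 : 0 < K by [].
  (* With [4 * d] pairs and at most [d] targets, the count is at most d times 16 K^2 + 20 K + 12;
     since K is positive, this is at most 48 d K^2. *)
  apply: (@leq_trans (48 * d * K ^ 2)); last by rewrite !leq_mul.
  by apply: leq_trans (leq_add Pd szD) _; nia.
move=> X; have [i [l [r [iS cl cr E]]]] := sigma_tildeE sol X vars.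
have vI : valid_interval ginv sys sigma (i, l, r).
  by split=> //; split; apply: cut_le.
have mU J : J \in sigma_tilde ginv sys sigma X -> maxfree ginv sys sigma J.
  by rewrite E; apply: units_maxfree.
rewrite eval_word //= => [|a /mapP[J /mU/repP[mJ _] ->//]].
by apply: Forall2_map_l => J /mU/repP[].
Qed.
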